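(* Let $(X,d)$ be a complete $b$-rectangular metric space with coefficient $s>1$ and let $T:X\to X$ be a $(\phi,F)$-contraction of type $(\Im)$, i.e. there exist functions $F:(0,+\infty)\to\mathbb{R}$ and $\phi:(0,+\infty)\to(0,+\infty)$ satisfying conditions (i)--(iv) listed in the context such that for all $x,y\in X$, $$d(Tx,Ty)>0\ \Longrightarrow\ F\big(s^2d(Tx,Ty)\big)+\phi\big(d(x,y)\big)\le F\big(M(x,y)\big),$$ where $$M(x,y)=\max\{d(x,y),\,d(x,Tx),\,d(y,Ty),\,d(y,Tx)\}.$$ Then $T$ has a unique fixed point.
   Context: A $b$-rectangular metric space with coefficient $s\ge 1$ is a nonempty set $X$ with a map $d:X\times X\to[0,+\infty)$ such that for all $x,y\in X$ and all distinct points $u,v\in X$, each distinct from $x$ and $y$: (1) $d(x,y)=0$ if and only if $x=y$; (2) $d(x,y)=d(y,x)$; (3) $d(x,y)\le s[d(x,u)+d(u,v)+d(v,y)]$. A sequence $(x_n)$ converges to $x$ if $d(x_n,x)\to 0$; it is Cauchy if $d(x_n,x_m)\to 0$ as $n,m\to\infty$; the space is complete if every Cauchy sequence converges to some point of $X$. Conditions on $F$ and $\phi$: (i) $F$ is strictly increasing; (ii) for each sequence $(x_n)$ of positive numbers, $\lim_{n\to\infty}x_n=0$ if and only if $\lim_{n\to\infty}F(x_n)=-\infty$; (iii) $\liminf_{u\to\alpha^+}\phi(u)>0$ for all $\alpha>0$; (iv) $F$ is continuous. *)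

(* Defs.v *)
From HB Require Import structures.
From mathcomp Require Import all_boot all_order all_algebra.
From mathcomp Require Import all_classical all_reals all_analysis.
Set Implicit Arguments.
Unset Strict Implicit.
Unset Printing Implicit Defensive.
Import Order.TTheory GRing.Theory Num.Theory.
Import numFieldNormedType.Exports.
Local Open Scope classical_set_scope.
Local Open Scope ring_scope.

(* In the rectangular inequality x and y are allowed to coincide. *)
Record b_rectangular_metric (R : realType) (X : Type) (d : X -> X -> R)
    (s : R) : Prop := {
  brm_inhabited : inhabited X ;
  brm_coef_ge1 : 1 <= s ;
  brm_ge0 : forall x y, 0 <= d x y ;
  brm_eq0 : forall x y, d x y = 0 <-> x = y ;
  brm_sym : forall x y, d x y = d y x ;
  brm_rect : forall x y u v,
    u <> v -> u <> x -> u <> y -> v <> x -> v <> y ->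
    d x y <= s * (d x u + d u v + d v y)
}.

Definition d_converges (R : realType) (X : Type) (d : X -> X -> R)
    (x_ : nat -> X) (x : X) : Prop :=
  d (x_ n) x @[n --> \oo] --> (0 : R).

Definition d_cauchy (R : realType) (X : Type) (d : X -> X -> R)
    (x_ : nat -> X) : Prop :=
  d (x_ p.1) (x_ p.2) @[p --> (\oo, \oo)] --> (0 : R).

Definition d_complete (R : realType) (X : Type) (d : X -> X -> R) : Prop :=
  forall x_ : nat -> X, d_cauchy d x_ -> exists x, d_converges d x_ x.

(* F : ]0, +oo[ -> R and phi : ]0, +oo[ -> ]0, +oo[ are represented by total
   functions on R, of which only the values on ]0, +oo[ are constrained. *)
Record admissible_pair (R : realType) (F phi : R -> R) : Prop := {
  ap_phi_gt0 : forall u, 0 < u -> 0 < phi u ;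
  ap_F_increasing : forall u v, 0 < u -> 0 < v -> u < v -> F u < F v ;
  ap_F_lim : forall x_ : nat -> R, (forall n, 0 < x_ n) ->
    (x_ n @[n --> \oo] --> (0 : R)) <-> (F (x_ n) @[n --> \oo] --> -oo%R) ;
  ap_phi_liminf : forall alpha, 0 < alpha ->
    (0 < limf_einf (fun u => (phi u)%:E) alpha^'+)%E ;
  ap_F_continuous : {within `]0, +oo[, continuous F}
}.

Definition contraction_max (R : realType) (X : Type) (d : X -> X -> R)
    (T : X -> X) (x y : X) : R :=
  Num.max (d x y) (Num.max (d x (T x)) (Num.max (d y (T y)) (d y (T x)))).

Definition phiF_contraction (R : realType) (X : Type) (d : X -> X -> R)
    (s : R) (T : X -> X) : Prop :=
  exists F phi : R -> R, admissible_pair F phi /\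
    forall x y, 0 < d (T x) (T y) ->
      F (s ^+ 2 * d (T x) (T y)) + phi (d x y) <= F (contraction_max d T x y).

(* Main.v *)
(** Strict monotonicity of [F] and positivity of [phi] already force
    [s ^ 2 * d (T x) (T y) <= M x y], so [T] is a quasi-contraction with constant
    [k = s ^ - 2], and [s * k < 1].  If [T] had no fixed point, every orbit would
    consist of distinct points, so that the rectangular inequality applies along
    it.  Through [T x] and [T^(m+1) x] it yields
    [d x (T^m x) <= s * (2 * d x (T x) + k * max (d x (T^m x), ...)) ],
    which bounds the orbit because [s * k < 1]; iterating the contraction then
    gives [d (T^n x) (T^(n+j) x) <= k ^ n * C].  The orbit is thus Cauchy, and the
    rectangular inequality through two consecutive iterates shows that its limit
    is fixed. *)
Require Import Defs.
From mathcomp Require Import all_boot all_order all_algebra.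
From mathcomp Require Import all_classical all_reals all_analysis.
From mathcomp Require Import ring lra.
Set Implicit Arguments.
Unset Strict Implicit.
Unset Printing Implicit Defensive.
Import Order.TTheory GRing.Theory Num.Theory.
Import numFieldNormedType.Exports.
Local Open Scope classical_set_scope.
Local Open Scope ring_scope.

Definition quasi_contraction (R : realType) (X : Type) (d : X -> X -> R)
    (k : R) (T : X -> X) : Prop :=
  forall x y, d (T x) (T y) <= k * contraction_max d T x y.

Lemma phiF_quasi_contraction (R : realType) (X : Type) (d : X -> X -> R)
    (s : R) (T : X -> X) :
  b_rectangular_metric d s -> 0 < s -> phiF_contraction d s T ->
  quasi_contraction d (s ^- 2) T.
Proof.
move=> hd s0 [F [phi [adm hT]]] x y.
rewrite ler_pdivlMl ?exprn_gt0//.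
set M := contraction_max d T x y.
have dM : d x y <= M by rewrite /M /contraction_max le_max lexx.
have [Txy0|Txy_neq0] := eqVneq (d (T x) (T y)) 0.
  by rewrite Txy0 mulr0 (le_trans _ dM)// (brm_ge0 hd).
have Txy_gt0 : 0 < d (T x) (T y) by rewrite lt_def Txy_neq0 (brm_ge0 hd).
(* [phi] is constrained only at positive arguments; [x = y] would force [T x = T y]. *)
have xy_gt0 : 0 < d x y.
  rewrite lt_def (brm_ge0 hd) andbT; apply: contra_neq Txy_neq0.
  by move=> /(brm_eq0 hd) ->; apply/(brm_eq0 hd).
rewrite leNgt; apply/negP => lt_M.
have M0 : 0 < M by exact: lt_le_trans dM.
have := ap_F_increasing adm M0 (lt_trans M0 lt_M) lt_M.
have := ap_phi_gt0 adm xy_gt0.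
have := hT _ _ Txy_gt0.
rewrite -/M; lra.
Qed.

Section QuasiContraction.
Context (R : realType) (X : Type) (d : X -> X -> R) (s k : R) (T : X -> X).
Context (hd : b_rectangular_metric d s) (k0 : 0 <= k) (sk1 : s * k < 1).
Context (hT : quasi_contraction d k T).

Let d_ge0 x y : 0 <= d x y := brm_ge0 hd x y.
Let d_sym x y : d x y = d y x := brm_sym hd x y.
Let s1 : 1 <= s := brm_coef_ge1 hd.

Let d_refl x : d x x = 0.
Proof. by apply/(brm_eq0 hd). Qed.

Lemma quasi_contraction_coef_lt1 : k < 1.
Proof.
by apply: le_lt_trans sk1; rewrite ler_peMl.
Qed.

Lemma quasi_contraction_le x y B : d x y <= B -> d x (T x) <= B ->
  d y (T y) <= B -> d y (T x) <= B -> d (T x) (T y) <= k * B.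
Proof.
move=> h1 h2 h3 h4; apply: (le_trans (hT x y)); rewrite ler_wpM2l//.
by rewrite /contraction_max !ge_max h1 h2 h3 h4.
Qed.

Lemma quasi_contraction_fixed_unique x y : T x = x -> T y = y -> x = y.
Proof.
move=> Tx Ty; apply/(brm_eq0 hd).
have := @quasi_contraction_le x y (d x y).
rewrite Tx Ty !d_refl (d_sym y x) => /(_ (lexx _) (d_ge0 _ _) (d_ge0 _ _) (lexx _)).
have := quasi_contraction_coef_lt1; have := d_ge0 x y; nra.
Qed.

(** With [y = T x] the term [d y (T x)] of the maximum vanishes and [d x (T y)] is not among its
    terms, so only two consecutive steps remain; since [k < 1], the later one cannot strictly
    dominate. *)
Lemma quasi_contraction_step x : d (T x) (T (T x)) <= k * d x (T x).
Proof.
have k1 := quasi_contraction_coef_lt1.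
have [le_d|lt_d] := leP (d (T x) (T (T x))) (d x (T x)).
  by apply: quasi_contraction_le => //; rewrite d_refl.
have := @quasi_contraction_le x (T x) (d (T x) (T (T x))).
rewrite d_refl => /(_ (ltW lt_d) (ltW lt_d) (lexx _) (d_ge0 _ _)).
have := d_ge0 x (T x); nra.
Qed.

Lemma quasi_contraction_iter_step x n :
  d (iter n T x) (iter n.+1 T x) <= k ^+ n * d x (T x).
Proof.
elim: n => [|n IHn]; first by rewrite expr0 mul1r.
rewrite exprS -mulrA; apply: le_trans (ler_wpM2l k0 IHn).
exact: quasi_contraction_step.
Qed.

Lemma quasi_contraction_iter_step_le x n :
  d (iter n T x) (iter n.+1 T x) <= d x (T x).
Proof.
apply: (le_trans (quasi_contraction_iter_step x n)).
by rewrite ler_piMl// exprn_ile1// ltW// quasi_contraction_coef_lt1.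
Qed.

Section NoFixedPoint.
Context (nofix : forall x, T x <> x).

Let step_gt0 x : 0 < d x (T x).
Proof.
rewrite lt_def d_ge0 andbT; apply/eqP => /(brm_eq0 hd) xTx.
by case: (nofix (esym xTx)).
Qed.

(** A repetition makes [y = iter n T x] periodic, so its positive first step recurs after [j.+1]
    iterations, although by then it has shrunk by the factor [k ^+ j.+1 < 1]. *)
Lemma quasi_contraction_iter_neq x n m : (n < m)%N -> iter n T x <> iter m T x.
Proof.
move=> /subnK <-; rewrite addnS -addSn iterD.
move: (m - _)%N (iter n T x) => j y {x n m} yj.
have := quasi_contraction_iter_step y j.+1.
rewrite [iter j.+2 T y]iterS -yj.
have : k ^+ j.+1 < 1 by rewrite exprn_ilt1// quasi_contraction_coef_lt1.
have := step_gt0 y; nra.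
Qed.

(** The solution [B] of [B = s * (2 * d x (T x) + k * B)], the equality case of the rectangular
    estimate. *)
Definition orbit_bound x : R := 2 * s * d x (T x) / (1 - s * k).

Let orbit_boundE x : orbit_bound x * (1 - s * k) = 2 * s * d x (T x).
Proof. by rewrite /orbit_bound mulfVK// subr_eq0 eq_sym lt_eqF. Qed.

Lemma step_le_orbit_bound x : d x (T x) <= orbit_bound x.
Proof.
rewrite /orbit_bound ler_pdivlMr ?subr_gt0//.
have := mulr_ge0 (d_ge0 x (T x)) (mulr_ge0 (le_trans ler01 s1) k0).
have := ler_wpM2r (d_ge0 x (T x)) s1; have := d_ge0 x (T x); lra.
Qed.

(** The two bounds are proved together: the second controls the term [d y (T x)] of the maximum when
    [y = iter m T x]. *)
Lemma orbit_bounded x m :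
  d x (iter m T x) <= orbit_bound x /\ d (T x) (iter m T x) <= orbit_bound x.
Proof.
have B_step := step_le_orbit_bound x.
have B0 : 0 <= orbit_bound x := le_trans (d_ge0 _ _) B_step.
have s0 : 0 <= s := le_trans ler01 s1.
have k1 := quasi_contraction_coef_lt1.
(* The points [x], [T x], [y], [T y] used below are distinct only from exponent 2 on. *)
elim: m => [|[_|m [IH0 IH1]]] /=.
- by rewrite d_refl d_sym.
- by rewrite d_refl.
have B1 : d (T x) (iter m.+2 T x) <= orbit_bound x.
  apply: (@le_trans _ _ (k * orbit_bound x)); last by rewrite ler_piMl// ltW.
  apply: quasi_contraction_le => //.
    exact: le_trans (quasi_contraction_iter_step_le x m.+1) B_step.
  by rewrite d_sym.
(* Above the bound, [d x y] would dominate the maximum, giving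
   [d x y <= s * (2 * d x (T x) + k * d x y)], which puts it back below the bound. *)
split=> //; rewrite leNgt; apply/negP => lt_B.
set y := iter m.+2 T x in B1 lt_B *.
have yT : d y (T y) <= d x (T x) by exact: quasi_contraction_iter_step_le x m.+2.
have h : d (T x) (T y) <= k * d x y.
  apply: quasi_contraction_le => //; first exact: le_trans B_step (ltW lt_B).
    exact: le_trans yT (le_trans B_step (ltW lt_B)).
  by rewrite d_sym (le_trans B1 (ltW lt_B)).
have := brm_rect hd (x := x) (y := y) (u := T x) (v := T y).
have h1 : T x <> T y by exact: (@quasi_contraction_iter_neq x 1 m.+3).
have h2 : T x <> y by exact: (@quasi_contraction_iter_neq x 1 m.+2).
have h3 : T y <> x by move=> /esym; exact: (@quasi_contraction_iter_neq x 0 m.+3).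
move=> /(_ h1 (@nofix x) h2 h3 (@nofix y)); rewrite [d (T y) y]d_sym.
have := ler_wpM2l s0 h; have := ler_wpM2l s0 yT.
have := orbit_boundE x.
have : 0 < (d x y - orbit_bound x) * (1 - s * k) by rewrite mulr_gt0 ?subr_gt0.
lra.
Qed.

(** Induction on [n], then on the gap [j]: the cross term [d y (T x)] of the maximum joins the
    iterates [n.+1] and [j + n.+1], so it keeps the exponent and shortens the gap. *)
Lemma orbit_dist_le x n j :
  d (iter n T x) (iter (j + n) T x) <= k ^+ n * orbit_bound x.
Proof.
have B_step := step_le_orbit_bound x.
have B0 : 0 <= orbit_bound x := le_trans (d_ge0 _ _) B_step.
have k1 := quasi_contraction_coef_lt1.
have kn_ge0 i : 0 <= k ^+ i by rewrite exprn_ge0.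
have step i m : (i <= m)%N ->
    d (iter m T x) (iter m.+1 T x) <= k ^+ i * orbit_bound x.
  move=> im; apply: le_trans (quasi_contraction_iter_step x m) _.
  by apply: ler_pM => //; rewrite ler_wiXn2l// ltW.
elim: n j => [|n IHn] j.
  by rewrite expr0 mul1r addn0; exact: (orbit_bounded x j).1.
elim: j => [|j IHj]; first by rewrite d_refl mulr_ge0.
rewrite addSn !iterS exprS -mulrA.
apply: quasi_contraction_le.
- by rewrite -addSnnS; exact: IHn.
- exact: step.
- by apply: step; rewrite addnS leqW// leq_addl.
- rewrite d_sym; apply: (le_trans IHj); rewrite exprS -mulrA.
  by apply: ler_piMl; [exact: mulr_ge0|exact: ltW].
Qed.

Lemma cvg_geometric_orbit c : k ^+ n * c @[n --> \oo] --> (0 : R).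
Proof.
rewrite -[X in _ --> X](mul0r c); apply: cvgMl.
by apply: cvg_expr; rewrite ger0_norm// quasi_contraction_coef_lt1.
Qed.

Lemma orbit_cauchy x : d_cauchy d (fun n => iter n T x).
Proof.
pose e n := k ^+ n * orbit_bound x.
have e_ge0 n : 0 <= e n.
  by rewrite mulr_ge0 ?exprn_ge0// (le_trans _ (step_le_orbit_bound x)).
have e_cvg : e n @[n --> \oo] --> (0 : R) by exact: cvg_geometric_orbit.
(* The sum bounds the distance whatever the order of [n] and [m], as the limit over pairs
   requires. *)
have d_le n m : d (iter n T x) (iter m T x) <= e n + e m.
  have [nm|/ltnW mn] := leqP n m.
    by rewrite -(subnK nm) (le_trans (orbit_dist_le _ _ _))// lerDl.
  by rewrite d_sym -(subnK mn) (le_trans (orbit_dist_le _ _ _))// lerDr.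
rewrite /d_cauchy.
apply: (@squeeze_cvgr _ _ _ _ (cst 0) (fun p => e p.1 + e p.2)).
- by near=> p; rewrite d_ge0 d_le.
- exact: cvg_cst.
- rewrite -[X in _ --> X](addr0 0); apply: cvgD.
  + exact: (cvg_comp _ _ cvg_fst e_cvg).
  + exact: (cvg_comp _ _ cvg_snd e_cvg).
Unshelve. all: by end_near. Qed.

(** By distinctness the orbit meets [w] at most once. *)
Lemma orbit_eventually_neq x w : \forall n \near \oo, iter n T x <> w.
Proof.
have [[N <-]|h] := pselect (exists N, iter N T x = w).
  near=> n => /esym; apply: quasi_contraction_iter_neq.
  by near: n; exact: nbhs_infty_gt.
by near=> n => nw; apply: h; exists n.
Unshelve. all: by end_near. Qed.

Lemma orbit_limit_fixed x z : d_converges d (fun n => iter n T x) z -> T z = z.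
Proof.
move=> xz; exfalso.
have a0 := step_gt0 z; set a := d z (T z) in a0.
have s0 : 0 < s := lt_le_trans ltr01 s1.
(* The rectangular inequality will give [a * (1 - s * k) <= 2 * s * e + 2 * s * k * e <= 4 * s * e],
   while this choice makes the left side [8 * s * e]. *)
pose e := a * (1 - s * k) / (8 * s).
have e0 : 0 < e by rewrite divr_gt0 ?mulr_gt0 ?subr_gt0.
have eE : 8 * (s * e) = a * (1 - s * k) by rewrite /e; field; rewrite gt_eqF.
have small u : u n @[n --> \oo] --> (0 : R) -> \forall n \near \oo, u n < e.
  by move=> u0; exact: (cvgr_lt _ u0).
have step_small : \forall n \near \oo, k ^+ n * d x (T x) < e.
  exact/small/cvg_geometric_orbit.
have xz1 : d (iter n.+1 T x) z @[n --> \oo] --> (0 : R).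
  by rewrite (cvg_shiftS (fun n => d (iter n T x) z)).
suff : \forall n \near \oo, False by move=> /filter_ex[].
near=> n.
have xn_z : iter n T x <> z by near: n; exact: orbit_eventually_neq.
have xn_Tz : iter n T x <> T z by near: n; exact: orbit_eventually_neq.
(* The shifted sequence is the orbit of [T x], so the same avoidance result applies. *)
have xSn_z : iter n.+1 T x <> z.
  by rewrite iterSr; near: n; exact: (orbit_eventually_neq (T x) z).
have xSn_Tz : iter n.+1 T x <> T z.
  by rewrite iterSr; near: n; exact: (orbit_eventually_neq (T x) (T z)).
have d1 : d (iter n T x) z < e by near: n; exact: small xz.
have d2 : d (iter n.+1 T x) z < e by near: n; exact: small xz1.
have d3 : d (iter n T x) (iter n.+1 T x) < e.
  apply: le_lt_trans (quasi_contraction_iter_step x n) _.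
  by near: n.
have h : d (iter n.+1 T x) (T z) <= k * (a + 2 * e).
  apply: quasi_contraction_le; [lra|lra|rewrite -/a; lra|].
  by rewrite d_sym -iterS; lra.
have xn_xSn : iter n.+1 T x <> iter n T x by exact: nofix.
have := brm_rect hd (nesym xn_xSn) xn_z xn_Tz xSn_z xSn_Tz.
rewrite [d z (iter n T x)]d_sym -/a => rect.
have : a <= s * (2 * e + k * (a + 2 * e)).
  by apply: (le_trans rect); rewrite ler_pM2l//; lra.
have : s * k * e <= e by apply: ler_piMl; exact: ltW.
have : e <= s * e by apply: ler_peMl => //; exact: ltW.
move: eE; lra.
Unshelve. all: by end_near. Qed.

End NoFixedPoint.

Theorem quasi_contraction_fixed_point : d_complete d -> exists! x, T x = x.
Proof.
move=> hc.
(* The orbit lemmas rely on distinct iterates, hence the case split. *)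
have [[x Tx]|nofix] := pselect (exists x, T x = x).
  by exists x; split=> // y; exact: quasi_contraction_fixed_unique.
have nofix' x : T x <> x by move=> Tx; apply: nofix; exists x.
have [x0] := brm_inhabited hd.
have [z xz] := hc _ (orbit_cauchy nofix' x0).
by case: nofix; exists z; exact: (@orbit_limit_fixed nofix' x0).
Qed.

End QuasiContraction.

Theorem theorem3p5 (R : realType) (X : Type) (d : X -> X -> R) (s : R)
    (T : X -> X) (hd : b_rectangular_metric d s) (hc : d_complete d)
    (hs : 1 < s) (hT : phiF_contraction d s T) :
  exists! x : X, T x = x.
Proof.
have s0 : 0 < s := lt_trans ltr01 hs.
apply: (@quasi_contraction_fixed_point _ _ d s (s ^- 2)) => //.
- by rewrite invr_ge0 exprn_ge0// ltW.
(* Here [s * s ^- 2 = s^-1], which is below 1 because [s > 1]. *)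
- by rewrite expr2 invfM mulrA mulfV ?gt_eqF// mul1r invf_lt1.
- exact: phiF_quasi_contraction.
Qed.
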